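(* Let $d$ be a positive integer congruent to $1$ modulo $4$. There exist permutations $\sigma_0,\sigma_1,\sigma_\infty$ in the symmetric group $\mathfrak{S}_d$ on $\{1,\ldots,d\}$ such that (i) $\sigma_0\sigma_1=\sigma_\infty$; (ii) the cycles in the decompositions of $\sigma_0$ and $\sigma_1$ have lengths $(1,4,\ldots,4)$, while those in the decomposition of $\sigma_\infty$ have lengths $(1,2,\ldots,2)$; (iii) the subgroup of $\mathfrak{S}_d$ generated by $\sigma_0,\sigma_1,\sigma_\infty$ is transitive on $\{1,\ldots,d\}$; if and only if $d$ is a sum of two squares. If they exist, $\sigma_0,\sigma_1,\sigma_\infty$ generate a group of order $4d$.
   Context: Cycle lengths include fixed points as cycles of length $1$: thus ''lengths $(1,4,\ldots,4)$'' means exactly one fixed point and $(d-1)/4$ cycles of length $4$, and ''lengths $(1,2,\ldots,2)$'' means exactly one fixed point and $(d-1)/2$ cycles of length $2$. ''Sum of two squares'' means $d=x^2+y^2$ for some integers $x,y\geq 0$, where $0$ is allowed.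
   Formalization: The claim that the permutations generate a group of order 4d is stated only for d > 1, since for d = 1 the only triple is (id, id, id), which generates the trivial group of order 1, not 4. *)

(* Defs.v *)
From mathcomp Require Import all_boot all_fingroup.

Set Implicit Arguments.
Unset Strict Implicit.
Unset Printing Implicit Defensive.

Local Open Scope group_scope.

(* [porbits s] contains the fixed points as singletons, so they are counted
   as cycles of length 1; multiplicities are kept, and the order in which the
   cycles are listed is irrelevant: compare with [perm_eq]. *)
Definition cycle_lengths d (s : 'S_d) : seq nat :=
  [seq #|C| | C : {set 'I_d} <- enum (porbits s)].

(* One fixed point and (d - 1) / k cycles of length k. *)
Definition has_lengths_1_k d k (s : 'S_d) : bool :=
  perm_eq (cycle_lengths s) (1%N :: nseq ((d - 1) %/ k) k).

Definition monodromy_group d (s0 s1 sinf : 'S_d) : {group 'S_d} :=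
  <<[set s0; s1; sinf]>>%G.

(* The product of ['S_d] composes from left to right.  The opposite convention
   amounts to exchanging [s0] and [s1], which leaves the other conditions
   unchanged. *)
Definition admissible_triple d (s0 s1 sinf : 'S_d) : Prop :=
  [/\ s0 * s1 = sinf,
      [/\ has_lengths_1_k 4 s0, has_lengths_1_k 4 s1 & has_lengths_1_k 2 sinf]
    & [transitive monodromy_group s0 s1 sinf, on [set: 'I_d] | 'P] ].

Definition sum_of_two_squares (d : nat) : Prop :=
  exists x y : nat, d = (x ^ 2 + y ^ 2)%N.

(* Main.v *)
(* The relations s0^4 = s1^4 = (s0 s1)^2 = 1 make the monodromy group a quotient
   of the triangle group Z[i] x| <i> of affine maps z -> i^k z + w, with s0 acting
   as z -> i z and s1 as z -> i z + 1.  Since s0 fixes a point, the abelian image T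
   of the translations is already transitive, hence regular: #|T| = d, and the
   group, which is T x| <s0>, has order 4 d.  As T is generated by one
   translation t and its conjugate by s0, it is a cyclic Z[i]-module, and
   comparing <t> with its conjugate writes d as m^2 r with r dividing some
   c^2 + 1; Thue's lemma makes r, hence d, a sum of two squares.

   Conversely, if d = x^2 + y^2 and alpha = x + i y, the ideal generated by alpha
   in Z[i] / d has d elements, because the kernel of the multiplication by alpha
   is the image of the multiplication by its conjugate; the maps z -> i z and
   z -> i z + alpha on this ideal are the required permutations, the uniqueness
   of their fixed points coming from the invertibility of 2 modulo d. *)
From HB Require Import structures.
Require Import Defs.
From mathcomp Require Import all_boot all_order all_fingroup all_algebra all_solvable.
From mathcomp Require Import zify ring.

Set Implicit Arguments.
Unset Strict Implicit.
Unset Printing Implicit Defensive.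

Import Order.TTheory GRing.Theory Num.Theory.

(* Thue's pigeonhole argument: two distinct pairs with entries at most
   [sqrt e] have the same image under [x + c * y] modulo [e]. *)
Lemma sum_of_two_squares_dvd (e c : nat) :
  0 < e -> e %| c ^ 2 + 1 -> sum_of_two_squares e.
Proof.
move=> e_gt0 e_dvd.
have [s s_le s_gt] : exists2 s, s ^ 2 <= e & e < s.+1 ^ 2.
  elim: e {e_dvd} e_gt0 => // n IHn _; case: n IHn => [_|n /(_ isT) [s]].
    by exists 1.
  move=> Hs; rewrite leq_eqVlt => /orP[/eqP Hn|Hn].
    by exists s.+1; rewrite ?Hn // ltn_exp2r.
  by exists s => //; apply: leq_trans Hs _.
pose f (p : 'I_s.+1 * 'I_s.+1) : 'I_e := Ordinal (ltn_pmod (p.1 + c * p.2) e_gt0).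
have /injectivePn [p [q pq fpq]] : ~~ injectiveb f.
  apply/negP => /injectiveP /leq_card; rewrite card_prod !card_ord; lia.
move/(congr1 val): fpq => /= /eqP fpq.
have [k Hk] : exists k : int,
  ((p.1 : nat)%:Z - (q.1 : nat)%:Z
   + c%:Z * ((p.2 : nat)%:Z - (q.2 : nat)%:Z) = k * e%:Z)%R.
  apply/dvdzP.
  have -> : ((p.1 : nat)%:Z - (q.1 : nat)%:Z + c%:Z * ((p.2 : nat)%:Z - (q.2 : nat)%:Z)
             = (p.1 + c * p.2)%N%:Z - (q.1 + c * q.2)%N%:Z)%R by lia.
  by rewrite -eqz_mod_dvd !modz_nat eqz_nat.
case/dvdnP: e_dvd => l Hl.
set A := (_ - _)%R in Hk; set B := (_ - _)%R in Hk.
(* Modulo [e], c^2 = -1, so A^2 + B^2 becomes (A + c B)(A - c B), whose first factor vanishes. *)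
have AB : (A ^+ 2 + B ^+ 2 = (k * (A - c%:Z * B) + l%:Z * B ^+ 2) * e%:Z)%R.
  have -> : (A ^+ 2 + B ^+ 2
    = (A + c%:Z * B) * (A - c%:Z * B) + (c ^ 2 + 1)%N%:Z * B ^+ 2)%R.
    rewrite PoszD -mulnn PoszM; ring.
  rewrite Hk Hl PoszM; ring.
set w := (k * _ + _)%R in AB.
pose x := `|A|%N; pose y := `|B|%N.
have xs : x <= s by have := ltn_ord p.1; have := ltn_ord q.1; lia.
have ys : y <= s by have := ltn_ord p.2; have := ltn_ord q.2; lia.
have xy_gt0 : 0 < x ^ 2 + y ^ 2.
  rewrite lt0n addn_eq0 !expn_eq0 /= !andbT; apply: contra pq => /andP[x0 y0].
  by apply/eqP; case: p q @A @B Hk @x @y x0 y0 {w AB xs ys fpq} => p1 p2 [q1 q2] /= *;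
     congr pair; apply/val_inj => /=; lia.
have [n xyE] : exists n, x ^ 2 + y ^ 2 = n * e.
  exists `|w|%N; apply/eqP; rewrite -eqz_nat; apply/eqP.
  have w_ge0 : (0 <= w * e%:Z)%R by rewrite -AB addr_ge0 ?sqr_ge0.
  have {}w_ge0 : (0 <= w)%R by move: w_ge0; rewrite pmulr_lge0 // ltz_nat.
  by rewrite PoszM PoszD -!mulnn !PoszM !abszE -!expr2 !real_normK ?num_real //
     (ger0_norm w_ge0).
have x2 : x ^ 2 <= s ^ 2 by rewrite leq_exp2r.
have y2 : y ^ 2 <= s ^ 2 by rewrite leq_exp2r.
have n_lt : n < 3 by rewrite -(ltn_pmul2r e_gt0); lia.
case: n n_lt xyE => [|[|[|//]]] _ xyE.
- by rewrite xyE in xy_gt0.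
- by exists x, y; rewrite xyE mul1n.
(* Here x^2 + y^2 = 2 e while both squares are at most [e], so each equals [e]. *)
- by exists x, 0; lia.
Qed.

(** * Cycle lengths *)

Local Open Scope group_scope.

Lemma porbit_mem_cycle_lengths d k (s : 'S_d) :
  k \in cycle_lengths s -> exists x, #|porbit s x| = k.
Proof.
by case/mapP => C; rewrite mem_enum => /imsetP[x _ ->] ->; exists x.
Qed.

Lemma has_lengths_1_kE d k (s : 'S_d) :
  0 < k -> has_lengths_1_k k s ->
  (exists x, s x = x) /\ s ^+ k = 1.
Proof.
move=> k_gt0 /perm_mem Hs; split.
  have [x x1] : exists x, #|porbit s x| = 1%N.
    by apply: porbit_mem_cycle_lengths; rewrite Hs mem_head.
  by exists x; have := iter_porbit s x; rewrite x1.
apply/permP => x; rewrite permX perm1.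
have : #|porbit s x| \in cycle_lengths s.
  by apply/mapP; exists (porbit s x); rewrite ?mem_enum ?imset_f.
rewrite Hs inE mem_nseq => /orP[/eqP x1|/andP[_ /eqP <-]]; last exact: iter_porbit.
have sx : s x = x by have := iter_porbit s x; rewrite x1.
by rewrite iter_fix.
Qed.

Lemma dvdn_porbit_order (T : finType) (s : {perm T}) x : #|porbit s x| %| #[s].
Proof. by rewrite porbitE; apply: dvdn_orbit. Qed.

(** The bound [k < d] forces a cycle of length [k] to occur, and its length divides the order. *)
Lemma has_lengths_1_k_order d k (s : 'S_d) :
  0 < k -> k < d -> has_lengths_1_k k s -> #[s] = k.
Proof.
move=> k_gt0 kd Hs; have [_ sk] := has_lengths_1_kE k_gt0 Hs.
apply/eqP; rewrite eqn_dvd order_dvdn sk eqxx /=.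
have [|x <-] := @porbit_mem_cycle_lengths d k s; last exact: dvdn_porbit_order.
rewrite (perm_mem Hs) inE mem_nseq eqxx divn_gt0 //.
by apply/orP; right; lia.
Qed.

(** The number of cycles of length [k] is forced, because all cycle lengths sum to [d]. *)
Lemma has_lengths_1_kI d k (s : 'S_d) x :
  0 < k -> s x = x -> (forall y, y != x -> #|porbit s y| = k) ->
  has_lengths_1_k k s.
Proof.
move=> k_gt0 sx sk.
have px : porbit s x = [set x].
  apply/setP => y; rewrite inE; apply/porbitP/eqP => [[i ->]|->]; last first.
    by exists 0; rewrite perm1.
  by rewrite permX iter_fix.
have xP : [set x] \in porbits s by rewrite -px imset_f.
set l := [seq #|C| | C : {set 'I_d} <- rem [set x] (enum (porbits s))].
have lE : perm_eq (cycle_lengths s) (1%N :: l).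
  rewrite -[X in X :: l](cards1 x) -(map_cons (fun C : {set 'I_d} => #|C|)).
  by apply/perm_map/perm_to_rem; rewrite mem_enum.
have lk : all (pred1 k) l.
  apply/allP => _ /mapP[C Cin ->] /=; move: Cin.
  rewrite mem_rem_uniq ?enum_uniq // !inE mem_enum => /andP[Cx /imsetP[y _ Cy]].
  by rewrite Cy sk //; apply: contra Cx => /eqP yx; rewrite Cy yx px.
have sumE : sumn (cycle_lengths s) = d.
  have /card_partition : partition (porbits s) [set: 'I_d].
    rewrite [porbits s](_ : _ = [set orbit 'P <[s]> x | x in [set: 'I_d]]); last first.
      by apply/setP => C; apply/imsetP/imsetP => -[y _ ->]; exists y; rewrite ?porbitE.
    apply: orbit_partition.
    by apply/actsP => a _ y; rewrite !inE.
  by rewrite cardsT card_ord sumnE big_map big_enum /= => <-.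
move/all_pred1P: lk lE; set n := size l => -> lE.
move: sumE; rewrite (perm_sumn lE) /= sumn_nseq => dE.
by rewrite /has_lengths_1_k (perm_trans lE) // -dE addKn mulKn.
Qed.

Lemma card_porbit_4 (T : finType) (s : {perm T}) x :
  s ^+ 4 = 1 -> s (s x) != x -> #|porbit s x| = 4%N.
Proof.
move=> s4 sx; have := dvdn_porbit_order s x; have := iter_porbit s x.
have : #[s] %| 4 by rewrite order_dvdn s4.
move=> /[swap] H /[swap] /dvdn_trans /[apply].
case: #|_| H => [|[|[|[|[|n]]]]] //= H.
- by rewrite !H eqxx in sx.
- by rewrite H eqxx in sx.
Qed.

Lemma card_porbit_2 (T : finType) (s : {perm T}) x :
  s ^+ 2 = 1 -> s x != x -> #|porbit s x| = 2%N.
Proof.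
move=> s2 sx; have := dvdn_porbit_order s x; have := iter_porbit s x.
have : #[s] %| 2 by rewrite order_dvdn s2.
move=> /[swap] H /[swap] /dvdn_trans /[apply].
case: #|_| H => [|[|[|n]]] //= H.
- by rewrite H eqxx in sx.
Qed.

(** * Translations in the triangle group *)

(* In the triangle group <a, b | a^4 = b^4 = (a b)^2 = 1>, acting on the
   complex plane with [a] the multiplication by i and [b : z -> i z + 1], the
   element [t] is the translation by 1 and its conjugate [t ^ a] the
   translation by i. *)
Section TriangleGroup.

Variables (gT : finGroupType) (a b : gT).
Hypotheses (a4 : a ^+ 4 = 1) (b4 : b ^+ 4 = 1) (ab2 : (a * b) ^+ 2 = 1).

Let t := a^-1 * b.
Let u := t ^ a.

Lemma triangle_bab : b * a * b = a^-1.
Proof.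
by apply: (mulgI a); rewrite mulgV !mulgA -[LHS]mulgA -expg2.
Qed.

Lemma triangle_aba : a * b * a = b^-1.
Proof. by apply: (mulIg b); rewrite mulVg -[LHS]mulgA -expg2. Qed.

(** For translations, this is i^2 = -1. *)
Lemma triangle_transl_conj : u ^ a = t^-1.
Proof.
rewrite /u /t !conjgE invMg invgK !mulgA -triangle_aba.
suff -> : a^-1 * a^-1 * a^-1 = a by rewrite ?mulgA.
apply: (mulgI a); rewrite !mulgA mulgV mul1g -!invMg.
by apply: (mulIg (a * a)); rewrite mulVg -a4 !expgS expg0 mulg1 !mulgA.
Qed.

Lemma triangle_transl_commute : commute t u.
Proof.
have ba : b * a = a^-1 * b^-1 by rewrite -triangle_bab -[RHS]mulgA mulgV mulg1.
have a3 : a^-1 ^+ 3 = a.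
  by apply: (mulIg (a ^+ 3)); rewrite expgVn mulVg -expgS a4.
have b3 : b^-1 * b^-1 = b * b.
  by apply: (mulIg (b * b)); rewrite -invMg mulVg -b4 !expgS expg0 mulg1 !mulgA.
rewrite /commute /u /t !conjgE.
(* Both products equal a^-2 b^2: at once for [u * t], through b a = a^-1 b^-1 for [t * u]. *)
transitivity (a^-1 * a^-1 * (b * b)); last by rewrite !mulgA mulgK.
transitivity (a^-1 * b * (a^-1 ^+ 3) * b^-1).
  by rewrite !expgS expg0 mulg1 -[_ * b * a]mulgA ba !mulgA.
by rewrite a3 -[a^-1 * b * a]mulgA ba -b3 !mulgA.
Qed.

Lemma triangle_orderJ : #[u] = #[t].
Proof. exact: orderJ. Qed.

Let T : {group gT} := (<[t]> <*> <[u]>)%G.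

Lemma triangle_transl_cent : <[u]> \subset 'C(<[t]>).
Proof.
by rewrite cent_cycle cycle_subG; apply/cent1P/commute_sym/triangle_transl_commute.
Qed.

Lemma triangle_translE : T = <[t]> * <[u]> :> {set gT}.
Proof. exact/cent_joinEr/triangle_transl_cent. Qed.

Lemma triangle_transl_abelian : abelian T.
Proof. by rewrite abelianY !cycle_abelian triangle_transl_cent. Qed.

Lemma triangle_norm : a \in 'N(T).
Proof.
rewrite inE /= conjYg -!cycleJ -/u triangle_transl_conj cycleV join_subG.
by rewrite joing_subl joing_subr.
Qed.

Lemma triangle_groupE : <<[set a; b; a * b]>> = T * <[a]>.
Proof.
rewrite -norm_joinEr ?cycle_subG ?triangle_norm //; apply/eqP; rewrite eqEsubset.
set G := <<_>>.
have aG : a \in G by rewrite mem_gen // !inE eqxx.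
have bG : b \in G by rewrite mem_gen // !inE eqxx orbT.
have tG : t \in G by rewrite groupM ?groupV.
apply/andP; split; last by rewrite !join_subG !cycle_subG aG tG groupJ.
rewrite gen_subG.
pose H := (T <*> <[a]>)%G; change ([set a; b; a * b] \subset H).
have aH : a \in H by apply: (subsetP (joing_subr T <[a]>)); apply: cycle_id.
have tH : t \in H.
  apply: (subsetP (joing_subl T <[a]>)); apply: (subsetP (joing_subl <[t]> <[u]>)).
  exact: cycle_id.
have bH : b \in H by rewrite -[b](mulKVg a) groupM.
by apply/subsetP => x; rewrite !inE => /orP[/orP[]|] /eqP -> //; rewrite groupM.
Qed.

(* With [n = #[t]], [r] the order of the intersection of the two cyclic groups
   and [m = n / r], conjugating [u ^+ m = t ^+ (m * c)] by [a] yields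
   [t ^+ (m * (c ^ 2 + 1)) = 1], that is [r %| c ^ 2 + 1]; and [#|T| = m ^ 2 * r]. *)
Lemma triangle_card_transl : sum_of_two_squares #|T|.
Proof.
pose n := #[t]; pose r := #|<[t]> :&: <[u]>|; pose m := n %/ r.
have r_gt0 : 0 < r := cardG_gt0 _.
have rn : r %| n by rewrite cardSg ?subsetIl.
have nE : n = (m * r)%N by rewrite divnK.
(* A cyclic group has a single subgroup of order [r], so the intersection is generated by [t ^+ m]
   and also by [u ^+ m]. *)
have tI : <[t]> :&: <[u]> = <[t ^+ m]>.
  have := cycle_sub_group rn => /setP /(_ (<[t]> :&: <[u]>)%G).
  by rewrite !inE subsetIl eqxx => /esym/eqP/(congr1 val).
have uI : <[t]> :&: <[u]> = <[u ^+ m]>.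
  have : r %| #[u] by rewrite triangle_orderJ.
  move=> /cycle_sub_group /setP /(_ (<[t]> :&: <[u]>)%G).
  by rewrite !inE subsetIr eqxx triangle_orderJ => /esym/eqP/(congr1 val).
have /cycleP[c uc] : u ^+ m \in <[t ^+ m]> by rewrite -tI uI cycle_id.
have [x [y xy]] : sum_of_two_squares r.
  apply: (@sum_of_two_squares_dvd _ c) => //.
  have m_gt0 : 0 < m by rewrite divn_gt0 // dvdn_leq ?order_gt0.
  rewrite -(dvdn_pmul2l m_gt0) -nE /n order_dvdn mulnDr muln1 expgD.
  have /(congr1 (conjg^~ a)) := uc; rewrite !conjXg triangle_transl_conj -/u uc.
  by rewrite expgVn -mulnn mulnA !expgM => <-; rewrite mulVg.
exists (m * x)%N, (m * y)%N; rewrite !expnMn -mulnDr -xy.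
apply/eqP; rewrite -(eqn_pmul2r r_gt0) /T /= triangle_translE.
rewrite -(mul_cardG <[t]> <[u]>) -!orderE triangle_orderJ -/n nE; lia.
Qed.

End TriangleGroup.

(** * Regular action of the translations and order of the monodromy group *)

Section AdmissibleTriple.

Variables (d : nat) (s0 s1 sinf : 'S_d).
Hypothesis adm : admissible_triple s0 s1 sinf.

Let T : {group 'S_d} := (<[s0^-1 * s1]> <*> <[(s0^-1 * s1) ^ s0]>)%G.

Lemma admissible_triangle :
  [/\ s0 ^+ 4 = 1, s1 ^+ 4 = 1 & (s0 * s1) ^+ 2 = 1].
Proof.
case: adm => -> [H0 H1 Hi] _.
by split; [have [] := has_lengths_1_kE _ H0|have [] := has_lengths_1_kE _ H1|
  have [] := has_lengths_1_kE _ Hi].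
Qed.

Lemma monodromy_groupE : monodromy_group s0 s1 sinf = T * <[s0]> :> {set 'S_d}.
Proof.
have [a4 b4 ab2] := admissible_triangle; case: adm => <- _ _.
exact: triangle_groupE.
Qed.

Lemma admissible_transl_regular x :
  s0 x = x -> #|T| = d /\ 'C_T[x | 'P] = 1.
Proof.
have [a4 b4 ab2] := admissible_triangle => sx.
have Tab : abelian T by exact: triangle_transl_abelian.
have T_orbit y : y \in orbit 'P T x.
  have : y \in orbit 'P (monodromy_group s0 s1 sinf) x.
    by case: adm => _ _ /atransP ->; rewrite inE.
  case/orbitP => g; rewrite monodromy_groupE.
  (* With the power of [s0] written first, it acts first and fixes [x], so [T] alone moves [x]
     everywhere. *)
  have /normC <- : <[s0]> \subset 'N(T) by rewrite cycle_subG triangle_norm.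
  case/mulsgP => _ h /cycleP[i ->] hT -> <-; apply/orbitP; exists h => //=.
  by rewrite !apermE permM permX iter_fix.
(* In an abelian group, an element fixing [x] fixes the whole orbit of [x], here every point. *)
have stab1 : 'C_T[x | 'P] = 1.
  apply/trivgP/subsetP => g /setIP[gT /astab1P /= gx]; rewrite inE; apply/eqP/permP => y.
  have /orbitP[h hT <-] := T_orbit y; rewrite perm1 /= !apermE -permM.
  by rewrite -(centsP Tab) // permM; congr (h _).
split=> //; have := card_orbit_stab 'P T x.
have -> : orbit 'P T x = [set: 'I_d] by apply/setP => y; rewrite inE T_orbit.
by rewrite stab1 cards1 muln1 cardsT card_ord.
Qed.

Lemma admissible_sum_of_two_squares : sum_of_two_squares d.
Proof.
have [a4 b4 ab2] := admissible_triangle.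
case: (adm) => _ [/has_lengths_1_kE[//|[x sx] _] _ _] _.
have [Td _] := admissible_transl_regular sx.
by have := triangle_card_transl a4 b4 ab2; rewrite -/T Td.
Qed.

Lemma admissible_card_monodromy_group :
  4 < d -> #|monodromy_group s0 s1 sinf| = (4 * d)%N.
Proof.
move=> d_gt4; have [a4 b4 ab2] := admissible_triangle.
case: (adm) => _ [H0 _ _] _; have [//|[x sx] _] := has_lengths_1_kE _ H0.
have [cardT stab1] := admissible_transl_regular sx.
rewrite monodromy_groupE TI_cardMg ?cardT; last first.
  apply/trivgP; rewrite -stab1 setIS // cycle_subG.
  by apply/astab1P.
by rewrite -orderE (has_lengths_1_k_order _ d_gt4 H0) // mulnC.
Qed.

End AdmissibleTriple.

Close Scope group_scope.

(** * Gaussian integers modulo d *)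

Local Open Scope ring_scope.

(** Every nonempty fibre is a coset of the kernel. *)
Lemma card_additive_image (U V : finZmodType) (f : U -> V) :
  {morph f : u v / u - v} ->
  #|U| = (#|f @: [set: U]| * #|[set u | f u == 0%R]|)%N.
Proof.
move=> fB; rewrite -cardsT -sum1_card.
rewrite (partition_big_imset f) -sum_nat_const; apply: eq_bigr => _ /imsetP[v _ ->].
rewrite sum1dep_card -[RHS](card_imset _ (addrI v)); apply: eq_card => u.
rewrite !inE /=; apply/eqP/imsetP => [fuv|[w]].
  by exists (u - v); rewrite ?inE ?fB ?fuv ?subrr // addrC subrK.
rewrite inE => /eqP fw ->; apply/eqP; rewrite -subr_eq0 -fB.
by rewrite addrC addKr fw.
Qed.

(** The bound matters: ['Z_d] is the ring of integers modulo [d] only when d > 1. *)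
Lemma intr_Zp_eq0 (d : nat) (k : int) :
  (1 < d)%N -> k%:~R = 0 :> 'Z_d -> exists l : int, k = d%:Z * l.
Proof.
move=> d_gt1.
have natP (n : nat) : n%:R = 0 :> 'Z_d -> exists l : int, n%:Z = d%:Z * l.
  move/(congr1 val); rewrite /= val_Zp_nat // => /eqP/dvdnP[l ->].
  by exists l%:Z; rewrite mulnC PoszM.
case: k => n; first exact: natP.
rewrite NegzE mulrNz => /eqP; rewrite oppr_eq0 => /eqP/natP[l ->].
by exists (- l); rewrite mulrN.
Qed.

(* Pairs represent the elements of R[i]; [gmul] is the multiplication by
   [x + y i] and [gmulC] the multiplication by its conjugate. *)
Section GaussianMultiplication.

Variables (R : comNzRingType) (x y : R).
Implicit Types z w : (R * R)%type.

Definition gmul z : R * R := (x * z.1 - y * z.2, x * z.2 + y * z.1).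
Definition gmulC z : R * R := (x * z.1 + y * z.2, x * z.2 - y * z.1).
Definition gconj z : R * R := (z.1, - z.2).
Definition gmuli z : R * R := (- z.2, z.1).

Lemma gmulB : {morph gmul : z w / z - w}.
Proof. by move=> z w; congr pair => /=; ring. Qed.

Lemma gmulD : {morph gmul : z w / z + w}.
Proof. by move=> z w; congr pair => /=; ring. Qed.

Lemma gmul_gmulC z : gmul (gmulC z) = ((x ^+ 2 + y ^+ 2) * z.1, (x ^+ 2 + y ^+ 2) * z.2).
Proof. by congr pair => /=; ring. Qed.

Lemma gmulC_conj z : gconj (gmulC (gconj z)) = gmul z.
Proof. by congr pair => /=; ring. Qed.

Lemma gconjK : involutive gconj.
Proof. by case=> a b; rewrite /gconj /= opprK. Qed.

Lemma gmul_i z : gmuli (gmul z) = gmul (gmuli z).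
Proof. by congr pair => /=; ring. Qed.

Lemma gmuliD : {morph gmuli : z w / z + w}.
Proof. by move=> z w; congr pair => /=; ring. Qed.

Lemma gmuliK z : gmuli (gmuli z) = - z.
Proof. by []. Qed.

End GaussianMultiplication.

(* The join of the finite and additive structures on products. *)
HB.instance Definition _ (U V : finZmodType) := Finite.on (U * V)%type.

Section GaussianModule.

Variables (d x y : nat).
Hypotheses (d_gt1 : (1 < d)%N) (dE : d = (x ^ 2 + y ^ 2)%N).

Let X : 'Z_d := x%:R.
Let Y : 'Z_d := y%:R.

(** Let alpha = x + i y. If z lifts an element of the kernel, then alpha z = d w over the Gaussian
    integers. Multiplying by the conjugate of alpha and cancelling d, the norm of alpha, shows that
    z is that conjugate times w. *)
Lemma gmul_ker : [set z | gmul X Y z == 0] = gmulC X Y @: [set: 'Z_d * 'Z_d].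
Proof.
have norm0 : X ^+ 2 + Y ^+ 2 = 0 by rewrite -!natrX -natrD -dE pchar_Zp.
apply/setP => -[a b]; rewrite inE; apply/eqP/imsetP => [|[z _ ->]]; last first.
  by rewrite gmul_gmulC norm0 !mul0r.
have intE (c : 'Z_d) : c = (c : nat)%:Z%:~R by rewrite -[LHS]natr_Zp.
rewrite (intE a) (intE b); set a' := (a : nat)%:Z; set b' := (b : nat)%:Z.
move=> ab0; have /= H1 := congr1 fst ab0; have /= H2 := congr1 snd ab0.
have [k Hk] : exists k : int, x%:Z * a' - y%:Z * b' = d%:Z * k.
  by apply: intr_Zp_eq0 => //; rewrite intrB !intrM.
have [l Hl] : exists l : int, x%:Z * b' + y%:Z * a' = d%:Z * l.
  by apply: intr_Zp_eq0 => //; rewrite intrD !intrM.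
have dZ : d%:Z = x%:Z ^+ 2 + y%:Z ^+ 2 by rewrite dE PoszD -!mulnn !PoszM !expr2.
have d_neq0 : d%:Z != 0 by rewrite eqz_nat -lt0n ltnW.
exists (k%:~R, l%:~R); first by rewrite inE.
rewrite /gmulC /= /X /Y.
rewrite !pmulrn -!intrM -intrD -intrB.
congr (_%:~R, _%:~R); apply: (mulfI d_neq0).
  by rewrite mulrDr !(mulrCA d%:Z) -Hk -Hl dZ; ring.
by rewrite mulrBr !(mulrCA d%:Z) -Hk -Hl dZ; ring.
Qed.

(** Conjugation matches the images of [gmul] and [gmulC], so kernel and image of [gmul] have the
    same size, whose square is d^2. *)
Lemma card_gmul_image : #|gmul X Y @: [set: 'Z_d * 'Z_d]| = d.
Proof.
have eqC : #|gmulC X Y @: [set: 'Z_d * 'Z_d]| = #|gmul X Y @: [set: 'Z_d * 'Z_d]|.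
  have imC : [set: 'Z_d * 'Z_d] = @gconj _ @: [set: 'Z_d * 'Z_d].
    by apply/setP => z; rewrite inE -[z]gconjK imset_f.
  rewrite [in LHS]imC -(card_imset _ (inv_inj (@gconjK _))) -!imset_comp.
  by rewrite (eq_imset _ (gmulC_conj X Y)).
have cardM : #|{: 'Z_d * 'Z_d}| = (d * d)%N by rewrite card_prod card_ord Zp_cast.
have : (d * d = #|gmul X Y @: [set: 'Z_d * 'Z_d]| * #|gmul X Y @: [set: 'Z_d * 'Z_d]|)%N.
  by rewrite -cardM -{2}eqC -gmul_ker; apply/card_additive_image/gmulB.
by rewrite !mulnn => /eqP; rewrite eqn_exp2r // => /eqP.
Qed.

End GaussianModule.

(** * Permutations induced by affine maps of a module where [J] acts as i *)

Section GaussianPermutations.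

Variables (d : nat) (V : zmodType) (J : V -> V) (alpha : V) (f : 'I_d -> V).
Variables s0 s1 : 'S_d.
Hypotheses (JD : {morph J : z w / z + w}) (JK : forall z, J (J z) = - z).
Hypotheses (f_inj : injective f) (mul2I : injective (fun z : V => z *+ 2)).
Hypotheses (s0E : forall i, f (s0 i) = J (f i)).
Hypotheses (s1E : forall i, f (s1 i) = J (f i) + alpha).

(** The map z -> J z + c and its square z -> -z + (J c + c) have the same unique fixed point, half
    of J c + c; every other cycle thus has length 4. *)
Lemma gaussian_rotation_lengths (s : 'S_d) (c : V) i0 :
  (forall i, f (s i) = J (f i) + c) -> f i0 *+ 2 = J c + c ->
  has_lengths_1_k 4 s.
Proof.
move=> sE f0.
have ssE i : f (s (s i)) = - f i + (J c + c) by rewrite !sE JD JK addrA.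
apply: (@has_lengths_1_kI _ _ _ i0) => // [|i i_neq].
  have Jf0 : J (f i0) *+ 2 = J c - c.
    by rewrite mulr2n -JD -mulr2n f0 JD JK addrC.
  by apply/f_inj/mul2I; rewrite /= sE mulrnDl f0 Jf0 mulr2n addrA subrK.
apply: card_porbit_4.
  apply/permP => j; rewrite permX perm1 /=; apply: f_inj.
  by rewrite !ssE opprD opprK addrNK.
apply: contra i_neq => /eqP/(congr1 f); rewrite ssE => fi.
by apply/eqP/f_inj/mul2I; rewrite /= f0 mulr2n -{1}fi addrAC addNr add0r.
Qed.

(** The indices [i0], [i1], [i2] are the fixed points of [s0], [s1] and [s0 * s1], the last acting
    as z -> -z + alpha. The spanning hypothesis yields transitivity through the translations by
    [alpha] and [J alpha]. *)
Lemma gaussian_admissible i0 i1 i2 :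
  f i0 = 0 -> f i1 *+ 2 = J alpha + alpha -> f i2 *+ 2 = alpha ->
  (forall i, exists n m, f i = alpha *+ n + J alpha *+ m) ->
  admissible_triple s0 s1 (s0 * s1)%g.
Proof.
move=> f0 f1 f2 span.
have J0 : J 0 = 0 by apply: (addrI (J 0)); rewrite -JD !addr0.
have sE i : f ((s0 * s1)%g i) = - f i + alpha by rewrite permM s1E s0E JK.
split=> //.
  split.
  - apply: (@gaussian_rotation_lengths _ 0 i0) => [i|]; first by rewrite s0E addr0.
    by rewrite f0 J0 addr0 mul0rn.
  - exact: gaussian_rotation_lengths f1.
  - apply: (@has_lengths_1_kI _ _ _ i2) => // [|i i_neq].
      by apply: f_inj; rewrite sE -f2 mulr2n addKr.
    apply: card_porbit_2.
      apply/permP => j; rewrite permX perm1 /=; apply: f_inj.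
      by rewrite !sE opprD opprK addrNK.
    apply: contra i_neq => /eqP/(congr1 f); rewrite sE => fi.
    by apply/eqP/f_inj/mul2I; rewrite /= f2 mulr2n -{1}fi addrAC addNr add0r.
set G := monodromy_group _ _ _.
have s0G : s0 \in G by rewrite mem_gen // !inE eqxx.
have s1G : s1 \in G by rewrite mem_gen // !inE eqxx orbT.
pose t := (s0^-1 * s1)%g; pose u := (t ^ s0)%g.
have tE i : f (t i) = f i + alpha by rewrite permM s1E -s0E permKV.
have uE i : f (u i) = f i + J alpha.
  by rewrite /u conjgE 2!permM s0E tE JD -s0E permKV.
have tnE n i : f ((t ^+ n)%g i) = f i + alpha *+ n.
  by elim: n => [|n IHn]; rewrite ?perm1 ?addr0 // expgSr permM tE IHn mulrSr addrA.
have umE n i : f ((u ^+ n)%g i) = f i + J alpha *+ n.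
  by elim: n => [|n IHn]; rewrite ?perm1 ?addr0 // expgSr permM uE IHn mulrSr addrA.
have tG : t \in G by rewrite groupM ?groupV.
apply/imsetP; exists i0; rewrite ?inE //; apply/setP => i; rewrite inE.
apply/esym/orbitP; have [n [m fi]] := span i.
exists (t ^+ n * u ^+ m)%g; first by rewrite groupM ?groupX ?groupJ.
by apply: f_inj; rewrite /= apermE permM umE tnE f0 add0r fi.
Qed.

End GaussianPermutations.

(** * Construction of the triple from a sum of two squares *)

Lemma exists_perm_of_stable (T : finType) d (f : 'I_d -> T) (s : T -> T) :
  injective f -> injective s -> (forall i, exists j, f j = s (f i)) ->
  exists p : 'S_d, forall i, f (p i) = s (f i).
Proof.
move=> f_inj s_inj /fin_all_exists[g gE].
have g_inj : injective g.
  by move=> i j gij; apply/f_inj/s_inj; rewrite -!gE gij.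
by exists (perm g_inj) => i; rewrite permE.
Qed.

Lemma sum_of_two_squares_admissible d :
  (1 < d)%N -> odd d -> sum_of_two_squares d ->
  exists s0 s1 sinf : 'S_d, admissible_triple s0 s1 sinf.
Proof.
move=> d_gt1 d_odd [x [y dE]].
pose X : 'Z_d := x%:R; pose Y : 'Z_d := y%:R.
pose A := gmul X Y @: [set: 'Z_d * 'Z_d].
have cardA : #|A| = d by exact: card_gmul_image.
pose f (i : 'I_d) : 'Z_d * 'Z_d := enum_val (cast_ord (esym cardA) i).
have f_inj : injective f by move=> i j /enum_val_inj/cast_ord_inj.
have fP i : exists z, f i = gmul X Y z.
  by have /imsetP[z _ fz] := enum_valP (cast_ord (esym cardA) i); exists z.
have f_surj z : exists i, f i = gmul X Y z.
  have zA : gmul X Y z \in A by apply: imset_f; rewrite inE.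
  exists (cast_ord cardA (enum_rank_in zA (gmul X Y z))).
  by rewrite /f cast_ordK enum_rankK_in.
pose alpha := gmul X Y (1, 0).
have i_inj : injective (@gmuli 'Z_d).
  by move=> z w /(congr1 (@gmuli _)); rewrite !gmuliK => /oppr_inj.
have [s0 s0E] : exists p : 'S_d, forall i, f (p i) = gmuli (f i).
  apply: (@exists_perm_of_stable _ _ _ (@gmuli 'Z_d)) => // i.
  have [z ->] := fP i; have [j fj] := f_surj (gmuli z).
  by exists j; rewrite gmul_i.
have [s1 s1E] : exists p : 'S_d, forall i, f (p i) = gmuli (f i) + alpha.
  apply: (@exists_perm_of_stable _ _ _ (fun z => gmuli z + alpha)) => //.
    by move=> z w /addIr/i_inj.
  move=> i.
  have [z ->] := fP i; have [j fj] := f_surj (gmuli z + (1, 0)).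
  by exists j; rewrite fj gmulD gmul_i.
have d0 : d%:R = 0 :> 'Z_d by rewrite pchar_Zp.
(* As [d] is odd, (d + 1) / 2 is the inverse of 2 modulo [d]. *)
pose h : 'Z_d := (d.+1)./2%:R.
have h2 : h *+ 2 = 1.
  by rewrite -mulrnA muln2 halfK /= d_odd subn0 mulrS d0 addr0.
have mul2I : injective (fun z : 'Z_d * 'Z_d => z *+ 2).
  move=> z w zw; have E (v : 'Z_d * 'Z_d) : v = (h * (v *+ 2).1, h * (v *+ 2).2).
    by case: v => a b; rewrite mulr2n /= -!mulr2n !mulrnAr -!mulrnAl h2 !mul1r.
  by rewrite (E z) (E w) zw.
(* The fixed points are 0, alpha (1 + i) / 2 and alpha / 2. *)
have [i0 f0] := f_surj 0.
have [i1 f1] := f_surj (h, h).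
have [i2 f2] := f_surj (h, 0).
have gmulM2 z : gmul X Y z *+ 2 = gmul X Y (z + z) by rewrite gmulD mulr2n.
exists s0, s1, (s0 * s1)%g.
apply: (@gaussian_admissible _ _ _ alpha f s0 s1 _ _ _ _ _ _ i0 i1 i2) => //.
- exact: gmuliD.
- exact: gmuliK.
- by rewrite f0; congr pair; rewrite /= !mulr0 ?subr0 ?addr0.
- rewrite f1 gmulM2 gmul_i -gmulD; congr (gmul _ _ _).
  by congr pair; rewrite /= -mulr2n h2 ?oppr0 ?add0r ?addr0.
- rewrite f2 gmulM2; congr (gmul _ _ _).
  by congr pair; rewrite /= -mulr2n ?h2 ?mul0rn.
(* Since alpha (a + b i) = a alpha + b (i alpha), the representatives of [a] and [b] count the
   translations. *)
move=> i; have [[a b] ->] := fP i; exists a, b.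
have natE (p : 'Z_d * 'Z_d) (c : 'Z_d) : p *+ c = (p.1 * c, p.2 * c).
  rewrite -[c in RHS]natr_Zp !mulr_natr; elim: (c : nat) => [|n IHn] //.
  by rewrite !mulrSr IHn.
by rewrite !natE; congr pair => /=; ring.
Qed.

Close Scope ring_scope.

(** This case stands apart because ['Z_1] has two elements. *)
Lemma admissible_triple_1 : exists s0 s1 sinf : 'S_1, admissible_triple s0 s1 sinf.
Proof.
have len k : (0 < k)%N -> has_lengths_1_k k (1%g : 'S_1).
  move=> k_gt0; apply: (@has_lengths_1_kI _ _ _ ord0) => // [|y].
    by rewrite perm1.
  by rewrite (ord1 y).
exists 1%g, 1%g, 1%g; split; rewrite ?mulg1 //; first by split; exact: len.
apply/imsetP; exists ord0; rewrite ?inE //; apply/setP => y.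
by rewrite inE (ord1 y) orbit_refl.
Qed.

(* For d = 1 the only triple is (1, 1, 1), which generates a group of order
   1 <> 4 * d; hence the hypothesis 1 < d in the claim on the order. *)
Theorem proposition2p1 (d : nat) (d_gt0 : 0 < d) (d_mod4 : d = 1 %[mod 4]) :
  ((exists s0 s1 sinf : 'S_d, admissible_triple s0 s1 sinf) <->
     sum_of_two_squares d) /\
  (1 < d -> forall s0 s1 sinf : 'S_d, admissible_triple s0 s1 sinf ->
     #|monodromy_group s0 s1 sinf| = 4 * d).
Proof.
split; last first.
  move=> d_gt1 s0 s1 sinf adm; apply: (admissible_card_monodromy_group adm).
  (* With d = 1 modulo 4, d > 1 already means d > 4. *)
  by case: d d_gt1 d_mod4 {d_gt0 s0 s1 sinf adm} => [|[|[|[|[|n]]]]].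
split=> [[s0 [s1 [sinf adm]]]|]; first exact: admissible_sum_of_two_squares adm.
have [d_gt1|d_le1] := ltnP 1 d; last first.
  have -> : d = 1 by lia.
  by move=> _; exact: admissible_triple_1.
by apply: sum_of_two_squares_admissible => //; lia.
Qed.
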